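(* Let $G$ be an abelian group (written multiplicatively), let $\Gamma$ be an additive abelian group, and let $M=\bigoplus_{g\in G}M_g$ be a graded $\Gamma$-ring of type $G$ with unity $1_{\gamma_0}$ (with respect to $\gamma_0\in\Gamma$). Then: (i) $M$ is strongly graded if and only if $1_{\gamma_0}\in M_g\Gamma M_{g^{-1}}$ for all $g\in G$. (ii) If $M$ is strongly graded, then the support of $M$ is $G$. (iii) Any crossed product $\Gamma$-ring is strongly graded. (iv) If $N$ is a graded $\Gamma$-ring (of type $G$), $\varphi:M\rightarrow N$ is a degree preserving homomorphism of $\Gamma$-rings, and $M$ is a strongly graded $\Gamma$-ring, then $N$ is strongly graded too.
   Context: Let $\Gamma$ be an additive abelian group. A $\Gamma$-ring (in the sense of Barnes) is an additive abelian group $M$ together with a map $M\times\Gamma\times M\to M$, $(x,\alpha,y)\mapsto x\alpha y$, such that for all $x,y,z\in M$ and $\alpha,\beta\in\Gamma$: $(x+y)\alpha z=x\alpha z+y\alpha z$, $x(\alpha+\beta)z=x\alpha z+x\beta z$, $x\alpha(y+z)=x\alpha y+x\alpha z$, and $(x\alpha y)\beta z=x\alpha(y\beta z)$. For subsets $A,B\subseteq M$, $A\Gamma B=\{a\alpha b\mid a\in A,\alpha\in\Gamma,b\in B\}$. $M$ is a graded $\Gamma$-ring of type $G$ if there are additive subgroups $M_g$ ($g\in G$) such that $M=\bigoplus_{g\in G}M_g$ and $M_g\Gamma M_h\subseteq M_{gh}$ for all $g,h\in G$. It is strongly graded if $M_g\Gamma M_h=M_{gh}$ for all $g,h\in G$.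 The support of $M$ is $\{g\in G\mid M_g\neq\{0\}\}$. A unity with respect to $\gamma_0\in\Gamma$ is an element $1_{\gamma_0}\in M$ with $a\gamma_0 1_{\gamma_0}=1_{\gamma_0}\gamma_0 a=a$ for all $a\in M$. An element $r\in M$ is invertible (with respect to $\gamma_0$) if there is $r^{-1}\in M$ with $r\gamma_0r^{-1}=r^{-1}\gamma_0r=1_{\gamma_0}$. A graded $\Gamma$-ring $M$ of type $G$ with unity $1_{\gamma_0}$, $G$ a group, is a crossed product if every component $M_g$ ($g\in G$) contains an invertible element. A homomorphism of $\Gamma$-rings $\varphi:M\to N$ is an additive map with $\varphi(x\gamma y)=\varphi(x)\gamma\varphi(y)$ for all $x,y\in M$, $\gamma\in\Gamma$; it is degree preserving if $\varphi(M_g)\subseteq N_g$ for all $g\in G$.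
   Formalization: In (ii), M is assumed nonzero, since the zero Γ-ring is strongly graded with empty support; in (iv), φ(1_{γ₀}) is assumed to be a unity of N with respect to γ₀, since φ = 0 is otherwise a counterexample. *)

(* Defs.v *)
From HB Require Import structures.
From mathcomp Require Import all_boot all_order all_algebra.
From mathcomp Require Import boolp classical_sets functions cardinality fsbigop.

Set Implicit Arguments.
Unset Strict Implicit.
Unset Printing Implicit Defensive.

Import GRing.Theory.
Local Open Scope ring_scope.
Local Open Scope classical_set_scope.

(* Gamma-rings in the sense of Barnes: [gmul x a y] is the product x a y. *)
HB.mixin Record Zmodule_isGammaRing (Gamma : zmodType) M
    of GRing.Zmodule M := {
  gmul : M -> Gamma -> M -> M;
  gmulDl : forall (x y : M) (a : Gamma) (z : M),
    gmul (x + y) a z = gmul x a z + gmul y a z;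
  gmulDm : forall (x : M) (a b : Gamma) (z : M),
    gmul x (a + b) z = gmul x a z + gmul x b z;
  gmulDr : forall (x : M) (a : Gamma) (y z : M),
    gmul x a (y + z) = gmul x a y + gmul x a z;
  gmulA : forall (x : M) (a : Gamma) (y : M) (b : Gamma) (z : M),
    gmul (gmul x a y) b z = gmul x a (gmul y b z)
}.

#[short(type="gammaRingType")]
HB.structure Definition GammaRing (Gamma : zmodType) :=
  {M of Zmodule_isGammaRing Gamma M & GRing.Zmodule M}.

Notation "x *[ a ] y" := (gmul x a y)
  (at level 40, a at level 200, left associativity, format "x  *[ a ]  y")
  : ring_scope.

Section GammaRings.
Variables (Gamma : zmodType) (M : gammaRingType Gamma).

(* The set A Gamma B of single products; no sums of products are taken. *)
Definition gamma_prod (A B : set M) : set M :=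
  [set x | exists a : M, exists alpha : Gamma, exists b : M,
     [/\ A a, B b & x = a *[alpha] b]].

Definition is_unity (gamma0 : Gamma) (u : M) : Prop :=
  forall a : M, a *[gamma0] u = a /\ u *[gamma0] a = a.

Definition invertible (gamma0 : Gamma) (u r : M) : Prop :=
  exists s : M, r *[gamma0] s = u /\ s *[gamma0] r = u.

Definition additive_subgroup (A : set M) : Prop :=
  A 0 /\ forall x y : M, A x -> A y -> A (x - y).

Section Graded.
Variables (G : groupType) (Mg : G -> set M).

(* [c] is a decomposition of [x] into homogeneous components. The finiteness
   clause matters: [\sum_(g \in setT)] is 0 on a family of infinite support. *)
Definition decomposition (x : M) (c : G -> M) : Prop :=
  [/\ forall g : G, Mg g (c g),
      finite_set [set g | c g <> 0] &
      x = \sum_(g \in [set: G]) c g].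

Record is_grading : Prop := IsGrading {
  grading_subgroup : forall g : G, additive_subgroup (Mg g);
  grading_direct : forall x : M, exists! c : G -> M, decomposition x c;
  grading_mul : forall g h : G,
    gamma_prod (Mg g) (Mg h) `<=` Mg (g * h)%g
}.

Definition strongly_graded : Prop :=
  forall g h : G, gamma_prod (Mg g) (Mg h) = Mg (g * h)%g.

Definition grading_support : set G := [set g | Mg g <> [set 0]].

Definition crossed_product (gamma0 : Gamma) (u : M) : Prop :=
  [/\ is_grading, is_unity gamma0 u &
      forall g : G, exists2 r : M, Mg g r & invertible gamma0 u r].

End Graded.
End GammaRings.

Definition gamma_hom (Gamma : zmodType) (M N : gammaRingType Gamma)
    (phi : M -> N) : Prop :=
  (forall x y : M, phi (x + y) = phi x + phi y) /\
  (forall (x : M) (gamma : Gamma) (y : M),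
     phi (x *[gamma] y) = phi x *[gamma] phi y).

Definition degree_preserving (Gamma : zmodType) (M N : gammaRingType Gamma)
    (G : groupType) (Mg : G -> set M) (Ng : G -> set N) (phi : M -> N) : Prop :=
  forall g : G, phi @` Mg g `<=` Ng g.

(* Main.v *)
(* If u = a alpha b with a in M_g and b in M_(g^-1), then x = u gamma0 x =
   a alpha (b gamma0 x) exhibits every x in M_(gh) as a single product from
   M_g Gamma M_h, so strong grading reduces to decomposing the unity u. The
   converse needs u to be homogeneous of degree 1: comparing components in
   r = r gamma0 u, for r homogeneous, shows that the degree 1 component of u is
   a right unity, hence equal to u. The same comparison of components in
   u = r gamma0 s shows that a homogeneous invertible element has a homogeneous
   right inverse. *)
Require Import Defs.
From HB Require Import structures.
From mathcomp Require Import all_boot all_order all_algebra.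
From mathcomp Require Import finmap.
From mathcomp Require Import boolp classical_sets functions cardinality fsbigop.

Set Implicit Arguments.
Unset Strict Implicit.
Unset Printing Implicit Defensive.

Import GRing.Theory.
Local Open Scope ring_scope.
Local Open Scope classical_set_scope.

(** Both sums reduce to one over the finite support of [F], since [f 0 = 0]. For infinite support
    the left side would be 0 by default, while the right side need not be. *)
Lemma additive_fsum (U V : zmodType) (f : U -> V) (I : choiceType)
    (F : I -> U) :
  {morph f : x y / x + y} -> finite_set [set i | F i <> 0] ->
  f (\sum_(i \in [set: I]) F i) = \sum_(i \in [set: I]) f (F i).
Proof.
move=> fD finF.
have f0 : f 0 = 0 by apply: (addrI (f 0)); rewrite -fD !addr0.
have F0 (i : I) : i \notin fset_set [set i | F i <> 0] -> F i = 0.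
  by rewrite in_fset_set// notin_setE => /contrapT.
rewrite (fsbigTE _ _ F0) (fsbigTE (fset_set [set i | F i <> 0])).
  exact: (big_morph f fD f0).
by move=> i /F0 ->.
Qed.

Section GammaRingTheory.
Variables (Gamma : zmodType) (M : gammaRingType Gamma).
Implicit Types (x y z r s u : M) (a : Gamma).

Lemma gmul0l a y : (0 : M) *[a] y = 0.
Proof. by apply: (addrI (0 *[a] y)); rewrite -gmulDl !addr0. Qed.

Lemma gmul0r x a : x *[a] (0 : M) = 0.
Proof. by apply: (addrI (x *[a] 0)); rewrite -gmulDr !addr0. Qed.

Section GradedTheory.
Variables (G : groupType) (Mg : G -> set M).
Hypothesis Mgr : is_grading Mg.

Lemma grading0 g : Mg g 0.
Proof. by case: (grading_subgroup Mgr g). Qed.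

Lemma grading_gmul g h x a y : Mg g x -> Mg h y -> Mg (g * h)%g (x *[a] y).
Proof. by move=> gx hy; apply: (grading_mul Mgr); exists x, a, y. Qed.

Lemma homogeneous_decomposition g x :
  Mg g x -> decomposition Mg x (fun h => if h == g then x else 0).
Proof.
move=> gx; split=> [h||].
- by case: eqP => [->//|_]; exact: grading0.
- apply: (sub_finite_set _ (finite_set1 g)) => h /=.
  by case: eqP.
- rewrite -(fsbig_widen [set g]) ?fsbig_set1 ?eqxx// => h [_ /= /eqP].
  by move=> /negPf ->.
Qed.

(** By uniqueness, [c] is the decomposition concentrated in degree [g]. *)
Lemma homogeneous_component g x (c : G -> M) :
  Mg g x -> decomposition Mg x c -> c g = x.
Proof.
move=> /homogeneous_decomposition dx cx.
have [d [_ d_uniq]] := grading_direct Mgr x.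
by rewrite -(d_uniq _ cx) (d_uniq _ dx) eqxx.
Qed.

(** Left multiplication by an element of degree [g] translates all degrees by [g]. *)
Lemma gmul_decomposition g r a x (c : G -> M) : Mg g r ->
  decomposition Mg x c ->
  decomposition Mg (r *[a] x) (fun k => r *[a] c (g^-1 * k)%g).
Proof.
move=> gr [homc finc xE]; split=> [k||].
- by rewrite -{1}(mulVKg g k); exact: grading_gmul.
- apply: (sub_finite_set _ (finite_image (fun h => g * h)%g finc)) => k /= rc.
  exists (g^-1 * k)%g; last by rewrite mulVKg.
  by move=> c0; apply: rc; rewrite c0 gmul0r.
- have gV_bij : bijective (fun k => g^-1 * k)%g.
    by exists (fun k => g * k)%g => k; rewrite ?mulKg ?mulVKg.
  rewrite -(reindex_fsbigT _ (fun h => r *[a] c h) gV_bij) xE.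
  by apply: (@additive_fsum _ _ (gmul r a)) => // y z; rewrite gmulDr.
Qed.

(** A homogeneous product equals its own component in its degree, and that component comes from
    [c k] alone. *)
Lemma gmul_component g k r a x (c : G -> M) :
  Mg g r -> decomposition Mg x c -> Mg (g * k)%g (r *[a] x) ->
  r *[a] c k = r *[a] x.
Proof.
move=> gr cx /homogeneous_component.
by move=> /(_ _ (gmul_decomposition a gr cx)); rewrite mulKg.
Qed.

Section Unity.
Variables (gamma0 : Gamma) (u : M).
Hypothesis u_unity : is_unity gamma0 u.

Lemma unity_homogeneous : Mg 1%g u.
Proof.
have [c [cu _]] := grading_direct Mgr u.
have [homc finc uE] := cu.
suff -> : u = c 1%g by exact: homc.
have cE h : c h *[gamma0] c 1%g = c h.
  by rewrite (gmul_component (homc h) cu) ?mulg1 (u_unity _).1.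
(* Expanding the left factor of [u *[gamma0] c 1%g = c 1%g] gives the sum of the [c h], which is
   [u]. *)
rewrite -[RHS](u_unity (c 1%g)).2 [in RHS]uE.
rewrite (@additive_fsum _ _ (fun x => x *[gamma0] c 1%g))//; last first.
  by move=> x y; rewrite gmulDl.
by rewrite {1}uE; apply: eq_fsbigr => h _; rewrite cE.
Qed.

Lemma strongly_gradedP : strongly_graded Mg <->
  forall g : G, gamma_prod (Mg g) (Mg (g^-1)%g) u.
Proof.
split=> [sg g|ug g h].
  by rewrite sg mulgV; exact: unity_homogeneous.
apply/seteqP; split=> [|x ghx]; first exact: grading_mul.
have [a [alpha [b [ga gb uE]]]] := ug g.
exists a, alpha, (b *[gamma0] x); split=> //.
  by rewrite -(mulKg g h); exact: grading_gmul.
by rewrite -gmulA -uE (u_unity x).2.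
Qed.

Lemma strongly_graded_support : (exists x : M, x <> 0) ->
  strongly_graded Mg -> grading_support Mg = [set: G].
Proof.
move=> [x x0] /strongly_gradedP ug; apply/seteqP; split=> // g _ /= g0.
have [a [alpha [b [+ _ uE]]]] := ug g.
(* If [Mg g] is trivial, the left factor [a] of [u] is 0, hence so are [u] and [x = u *[gamma0]
   x]. *)
rewrite g0 => /= a0; apply: x0.
by rewrite -(u_unity x).2 uE a0 !gmul0l.
Qed.

Lemma homogeneous_invertible g r : Mg g r -> invertible gamma0 u r ->
  gamma_prod (Mg g) (Mg (g^-1)%g) u.
Proof.
move=> gr [s [rs _]].
have [c [cs _]] := grading_direct Mgr s.
(* As [u] has degree 1, only the component of [s] in degree [g^-1] contributes to [r *[gamma0]
   s]. *)
exists r, gamma0, (c (g^-1)%g); split=> //; first by case: cs.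
by rewrite (gmul_component gr cs) rs// mulgV; exact: unity_homogeneous.
Qed.

End Unity.
End GradedTheory.
End GammaRingTheory.

Theorem theorem9p1 (G : groupType)
    (G_abelian : forall g h : G, (g * h)%g = (h * g)%g)
    (Gamma : zmodType) (M : gammaRingType Gamma) (Mg : G -> set M)
    (M_graded : is_grading Mg)
    (gamma0 : Gamma) (u : M) (u_unity : is_unity gamma0 u) :
  [/\ (* (i) *)
      strongly_graded Mg <->
        (forall g : G, gamma_prod (Mg g) (Mg (g^-1)%g) u),
      (* (ii), for M nonzero: the zero ring is strongly graded with empty
         support *)
      (exists x : M, x <> 0) ->
        strongly_graded Mg -> grading_support Mg = [set: G],
      (* (iii) *)
      crossed_product Mg gamma0 u -> strongly_graded Mg &
      (* (iv), for phi unital: N has a unity for gamma0 and phi preserves it;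
         otherwise phi = 0 is a counterexample *)
      forall (N : gammaRingType Gamma) (Ng : G -> set N) (phi : M -> N),
        is_grading Ng -> gamma_hom phi -> is_unity gamma0 (phi u) ->
        degree_preserving Mg Ng phi ->
        strongly_graded Mg -> strongly_graded Ng].
Proof.
split.
- exact: strongly_gradedP.
- exact: (strongly_graded_support M_graded u_unity).
- move=> [_ _ inv]; apply/(strongly_gradedP M_graded u_unity) => g.
  have [r gr] := inv g.
  exact: (homogeneous_invertible M_graded u_unity gr).
- move=> N Ng phi N_graded [_ phiM] phiu degphi.
  move=> /(strongly_gradedP M_graded u_unity) ug.
  apply/(strongly_gradedP N_graded phiu) => g.
  have [a [alpha [b [ga gb ->]]]] := ug g.
  exists (phi a), alpha, (phi b); split; last exact: phiM.
    by apply: degphi; exists a.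
  by apply: degphi; exists b.
Qed.
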